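(* For $K\in\mathbb{N}$ and $\gamma\in\mathcal{D}(\mathbf{2}\times\mathbf{2})$, $$\mathrm{mean}\big(\mathrm{bvbn}[K](\gamma)\big)=K\cdot\mathrm{mean}(\gamma)\ \in\ \mathbb{R}\times\mathbb{R}.$$
   Context: $\mathbf{2}=\{0,1\}$. For a set $X$, $\mathcal{D}(X)$ is the set of finitely supported probability distributions on $X$, i.e. functions $\omega\colon X\to[0,1]$ with finite support and $\sum_x\omega(x)=1$. For $f\colon X\to Y$, $\mathcal{D}(f)\colon\mathcal{D}(X)\to\mathcal{D}(Y)$ is the pushforward $\mathcal{D}(f)(\omega)(y)=\sum_{x\in f^{-1}(y)}\omega(x)$. For $\omega\in\mathcal{D}(X)$ and $p\colon X\to\mathbb{R}$ the validity (expected value) is $(\omega\models p)=\sum_{x}\omega(x)p(x)$. For a distribution $\omega\in\mathcal{D}(\mathbb{R}^N)$ (or on a subset of $\mathbb{R}^N$), $\mathrm{mean}(\omega)=\big(\omega\models\pi_1,\ldots,\omega\models\pi_N\big)\in\mathbb{R}^N$, where $\pi_i\colon\mathbb{R}^N\to\mathbb{R}$ are the projections. The sets $\mathbf{2}\times\mathbf{2}$ and $\{0,\ldots,K\}\times\{0,\ldots,K\}$ are regarded as subsets of $\mathbb{R}^2$. $\mathcal{M}[K](X)$ is the set of multisets over $X$ of size $K$, i.e. finitely supported functions $\varphi\colon X\to\mathbb{N}$ with $\sum_x\varphi(x)=K$. For $\omega\in\mathcal{D}(X)$ with $X$ finite, the multinomial distribution $\mathrm{mn}[K](\omega)\in\mathcal{D}(\mathcal{M}[K](X))$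 is $$\mathrm{mn}[K](\omega)(\varphi)=\frac{K!}{\prod_x\varphi(x)!}\prod_{x\in X}\omega(x)^{\varphi(x)}\qquad(0^0=1).$$ The marginal heads function $\mathrm{heads}\colon\mathcal{M}[K](\mathbf{2}\times\mathbf{2})\to\{0,\ldots,K\}\times\{0,\ldots,K\}$ is $\mathrm{heads}(\varphi)=\big(\varphi(1,0)+\varphi(1,1),\ \varphi(0,1)+\varphi(1,1)\big)$. The bivariate binomial distribution of $\gamma\in\mathcal{D}(\mathbf{2}\times\mathbf{2})$ with $K$ tosses is $$\mathrm{bvbn}[K](\gamma)=\mathcal{D}(\mathrm{heads})\big(\mathrm{mn}[K](\gamma)\big)\in\mathcal{D}\big(\{0,\ldots,K\}\times\{0,\ldots,K\}\big).$$ *)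

(* Defs.v *)
From HB Require Import structures.
From mathcomp Require Import all_boot all_order all_algebra.
From mathcomp Require Import finmap reals ring.

Set Implicit Arguments.
Unset Strict Implicit.
Unset Printing Implicit Defensive.

Import Order.TTheory GRing.Theory Num.Theory.

Local Open Scope fset_scope.
Local Open Scope ring_scope.

Lemma big_finsupp (V : Type) (idx : V) (op : Monoid.com_law idx)
    (W : eqType) (w0 : W) (X : choiceType) (f : {fsfun X -> W with w0})
    (S : {fset X}) (F : X -> V) :
  finsupp f `<=` S -> (forall x, f x = w0 -> F x = idx) ->
  \big[op/idx]_(x <- finsupp f) F x = \big[op/idx]_(x <- S) F x.
Proof.
move=> sub F0; apply: big_fset_incl => // x _ xf; exact/F0/fsfun_dflt.
Qed.

Lemma big_finsupp_fin (V : Type) (idx : V) (op : Monoid.com_law idx)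
    (W : eqType) (w0 : W) (X : finType) (f : {fsfun X -> W with w0})
    (F : X -> V) :
  (forall x, f x = w0 -> F x = idx) ->
  \big[op/idx]_(x <- finsupp f) F x = \big[op/idx]_x F x.
Proof.
move=> F0; rewrite big_uniq ?fset_uniq //= big_mkcond /=.
by apply: eq_bigr => x _; case: ifPn => // xf; rewrite F0 // fsfun_dflt.
Qed.

(* Finitely supported probability distributions. *)
Record dist (R : realType) (X : choiceType) := Dist {
  dist_fun :> {fsfun X -> R with 0};
  dist_itv : forall x, 0 <= dist_fun x <= 1;
  dist_sum1 : \sum_(x <- finsupp dist_fun) dist_fun x = 1 }.

Arguments dist R X%_type_scope.

Section Pushforward.
Context (R : realType) (X Y : choiceType) (f : X -> Y) (omega : dist R X).

Definition dmap_fun : {fsfun Y -> R with 0} :=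
  [fsfun y in f @` finsupp omega =>
     \sum_(x <- finsupp omega | f x == y) omega x].

Lemma dmap_funE y : dmap_fun y = \sum_(x <- finsupp omega | f x == y) omega x.
Proof.
rewrite fsfunE; case: ifPn => // yS; rewrite big_seq_cond big1 // => x.
by move=> /andP[xS /eqP fx]; rewrite -fx in_imfset in yS.
Qed.

Lemma dmap_sum (F : Y -> R) :
  \sum_(y <- finsupp dmap_fun) dmap_fun y * F y
  = \sum_(x <- finsupp omega) omega x * F (f x).
Proof.
rewrite (@big_finsupp _ _ _ _ _ _ _ (f @` finsupp omega)); first last.
- by move=> y ->; rewrite mul0r.
- by apply/fsubsetP => y; rewrite mem_finsupp fsfunE; case: ifP; rewrite ?eqxx.
under eq_bigr do rewrite dmap_funE big_distrl /= big_mkcond /=.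
rewrite exchange_big /= [LHS]big_seq [RHS]big_seq; apply: eq_bigr => x xS.
rewrite (big_fsetD1 (f x)) ?in_imfset //= eqxx.
rewrite big_seq big1 ?addr0 // => y; rewrite !inE eq_sym.
by case/andP => /negPf ->.
Qed.

Lemma dmap_sum1 : \sum_(y <- finsupp dmap_fun) dmap_fun y = 1.
Proof.
have := dmap_sum (fun=> 1); under [LHS]eq_bigr do rewrite mulr1.
under [RHS]eq_bigr do rewrite mulr1.
by move=> ->; apply: dist_sum1.
Qed.

Lemma dmap_itv y : 0 <= dmap_fun y <= 1.
Proof.
have ge0 x : 0 <= omega x by case/andP: (dist_itv omega x).
rewrite dmap_funE sumr_ge0 //= -(dist_sum1 omega) big_mkcond.
by apply: ler_sum => x _; case: ifP.
Qed.

Definition dmap : dist R Y := Dist dmap_itv dmap_sum1.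

End Pushforward.

Definition validity (R : realType) (X : choiceType) (omega : dist R X)
    (p : X -> R) : R :=
  \sum_(x <- finsupp omega) omega x * p x.

(* Mean of a distribution on a subset X of R^N, given by its inclusion iota;
   iota = id is the case X = R^N. *)
Definition mean (R : realType) (N : nat) (X : choiceType) (iota : X -> 'rV[R]_N)
    (omega : dist R X) : 'rV[R]_N :=
  \row_i validity omega (fun x => iota x 0 i).

(* The inclusion of {0, ..., m} x {0, ..., n} into R^2. *)
Definition grid (R : realType) (m n : nat) (p : 'I_m.+1 * 'I_n.+1) : 'rV[R]_2 :=
  \row_i (if i == 0 then p.1%:R else p.2%:R).

Lemma grid_inj (R : realType) (m n : nat) : injective (@grid R m n).
Proof.
move=> [i j] [i' j'] /rowP eg; congr (_, _); apply/val_inj/eqP.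
  by have /eqP := eg 0; rewrite !mxE /= eqr_nat.
by have /eqP := eg 1; rewrite !mxE /= eqr_nat.
Qed.

(* Finitely supported functions X -> nat of total K: multisets of size K. *)
Record msetn (K : nat) (X : choiceType) := Msetn {
  msetn_val :> {fsfun X -> nat with 0%N};
  _ : (\sum_(x <- finsupp msetn_val) msetn_val x)%N == K }.

HB.instance Definition _ K X := [isSub for @msetn_val K X].
HB.instance Definition _ K X := [Choice of msetn K X by <:].

Arguments msetn K X%_type_scope.

Section FiniteMultisets.
Context (X : finType).
Implicit Type K : nat.

Lemma msetn_sum K (phi : msetn K X) : (\sum_x phi x)%N = K.
Proof. by case: phi => phi /= /eqP <-; rewrite big_finsupp_fin. Qed.

Lemma msetn_le K (phi : msetn K X) x : (phi x <= K)%N.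
Proof. by rewrite -[leqRHS](msetn_sum phi) (bigD1 x) //= leq_addr. Qed.

Definition mset_of (g : X -> nat) : {fsfun X -> nat with 0%N} :=
  [fsfun x in [fset x | x in X] => g x].

Lemma mset_ofE g x : mset_of g x = g x.
Proof. by rewrite fsfunE in_fset. Qed.

Lemma mset_of_subproof K g : (\sum_x g x)%N = K ->
  (\sum_(x <- finsupp (mset_of g)) mset_of g x)%N == K.
Proof.
move=> <-; rewrite big_finsupp_fin //; apply/eqP/eq_bigr => x _.
exact: mset_ofE.
Qed.

Definition msetn_of K g (gK : (\sum_x g x)%N = K) : msetn K X :=
  Msetn (mset_of_subproof gK).

Lemma msetn_ofE K g (gK : (\sum_x g x)%N = K) x : msetn_of gK x = g x.
Proof. exact: mset_ofE. Qed.

Lemma msetnP K (phi psi : msetn K X) : phi =1 psi -> phi = psi.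
Proof. by move=> e; apply/val_inj/fsfunP. Qed.

Definition msetn_ffun K (phi : msetn K X) : {ffun X -> 'I_K.+1} :=
  [ffun x => Ordinal (msetn_le phi x : (phi x < K.+1)%N)].

Definition msetn_unffun K (g : {ffun X -> 'I_K.+1}) : option (msetn K X) :=
  insub (mset_of (fun x => g x)).

Lemma msetn_ffunK K : pcancel (@msetn_ffun K) (@msetn_unffun K).
Proof.
move=> phi; rewrite /msetn_unffun.
have -> : mset_of (fun x => msetn_ffun phi x) = val phi.
  by apply/fsfunP => x; rewrite mset_ofE ffunE.
by rewrite valK.
Qed.

HB.instance Definition _ K : isCountable (msetn K X) :=
  PCanIsCountable (@msetn_ffunK K).
HB.instance Definition _ K : isFinite (msetn K X) :=
  PCanIsFinite (@msetn_ffunK K).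

End FiniteMultisets.

Fact mn_mass_add_field (F : fieldType) (P f a k k' q v u : F) :
  P != 0 -> f != 0 -> a != 0 ->
  a * (k * k' / (a * f * P) * (u * v * q)) = k * u * (k' / (f * P) * (v * q)).
Proof. by move=> P0 f0 a0; field; rewrite P0 f0 a0. Qed.

Section Multinomial.
Context (R : realType) (X : finType).
Implicit Type K : nat.

Definition mn_mass K (w : X -> R) (phi : msetn K X) : R :=
  K`!%:R / (\prod_x (phi x)`!)%:R * \prod_x w x ^+ phi x.

Lemma msetn_add_subproof K x (psi : msetn K X) :
  (\sum_y (psi y + (y == x)))%N = K.+1.
Proof.
rewrite big_split /= msetn_sum -big_mkcond /=.
by rewrite sum1_card card1 addn1.
Qed.

Definition msetn_add K x (psi : msetn K X) : msetn K.+1 X :=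
  msetn_of (msetn_add_subproof x psi).

Lemma msetn_addE K x (psi : msetn K X) y :
  msetn_add x psi y = (psi y + (y == x))%N.
Proof. exact: msetn_ofE. Qed.

Lemma mn_mass_add K (w : X -> R) x (psi : msetn K X) :
  (msetn_add x psi x)%:R * mn_mass w (msetn_add x psi)
  = K.+1%:R * w x * mn_mass w psi.
Proof.
have e y : y != x -> msetn_add x psi y = psi y.
  by move=> /negPf yx; rewrite msetn_addE yx addn0.
have ex : msetn_add x psi x = (psi x).+1 by rewrite msetn_addE eqxx addn1.
have -> : mn_mass w psi = K`!%:R /
    ((psi x)`! * \prod_(y | y != x) (psi y)`!)%:R *
    (w x ^+ psi x * \prod_(y | y != x) w y ^+ psi y).
  by rewrite /mn_mass (bigD1 x) //= [X in _ * X = _](bigD1 x).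
have -> : mn_mass w (msetn_add x psi) = K.+1`!%:R /
    ((psi x).+1`! * \prod_(y | y != x) (psi y)`!)%:R *
    (w x ^+ (psi x).+1 * \prod_(y | y != x) w y ^+ psi y).
  rewrite /mn_mass (bigD1 x) //= [X in _ * X = _](bigD1 x) //= ex.
  by congr (_ / (_ * _)%:R * (_ * _)); apply: eq_bigr => y yx; rewrite e.
rewrite ex !factS exprS !natrM.
have P0 : (\prod_(y | y != x) (psi y)`!)%:R != 0 :> R.
  by rewrite pnatr_eq0 -lt0n prodn_gt0 // => y; exact: fact_gt0.
have f0 : (psi x)`!%:R != 0 :> R by rewrite pnatr_eq0 -lt0n fact_gt0.
have a0 : (psi x).+1%:R != 0 :> R by rewrite pnatr_eq0.
exact: mn_mass_add_field.
Qed.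

Lemma mn_mass_shift K (w : X -> R) x (F : msetn K.+1 X -> R) :
  \sum_(phi : msetn K.+1 X) (phi x)%:R * mn_mass w phi * F phi
  = K.+1%:R * w x * \sum_(psi : msetn K X) mn_mass w psi * F (msetn_add x psi).
Proof.
rewrite (bigID (fun phi : msetn K.+1 X => 0 < phi x)%N) /= addrC big1 ?add0r.
  pose del (phi : msetn K.+1 X) : option (msetn K X) :=
    insub (mset_of (fun y => phi y - (y == x))%N).
  rewrite (reindex_omap (msetn_add x) del) /=.
    rewrite big_distrr /=; apply: eq_big => psi.
      rewrite msetn_addE eqxx addn1 /=; apply/eqP; rewrite /del.
      rewrite (_ : mset_of _ = val psi) ?valK //.
      by apply/fsfunP => y; rewrite mset_ofE msetn_addE addnK.
    by move=> _; rewrite mn_mass_add !mulrA.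
  move=> phi phix; rewrite /del; case: insubP => [psi _ /fsfunP psiE|] /=.
    congr Some; apply: msetnP => y; rewrite msetn_addE psiE mset_ofE subnK //.
    by case: eqP => // ->.
  case/negP; apply: mset_of_subproof; rewrite sumnB => [|y _].
    by rewrite msetn_sum -big_mkcond /= sum1_card card1 subn1.
  by case: eqP => // ->.
by move=> phi; rewrite -eqn0Ngt => /eqP ->; rewrite !mul0r.
Qed.

Lemma mn_mass_sum K (w : X -> R) :
  \sum_(phi : msetn K X) mn_mass w phi = (\sum_x w x) ^+ K.
Proof.
elim: K => [|K IH].
  have s0 : (\sum_(x : X) 0)%N = 0%N by rewrite big1.
  rewrite (bigD1 (msetn_of s0)) //= big1 ?addr0.
    rewrite /mn_mass [X in X%:R^-1]big1 => [|x _]; last by rewrite msetn_ofE.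
    rewrite [X in _ * X = _]big1 => [|x _]; last by rewrite msetn_ofE.
    by rewrite divr1 mulr1.
  move=> phi /eqP[]; apply: msetnP => x; rewrite msetn_ofE.
  by apply/eqP; rewrite -leqn0 msetn_le.
have K0 : K.+1%:R != 0 :> R by rewrite pnatr_eq0.
apply: (mulfI K0); rewrite exprS mulrA -IH [LHS]mulr_sumr.
rewrite [X in _ = X * _]mulr_sumr [RHS]mulr_suml.
transitivity (\sum_x \sum_(phi : msetn K.+1 X) (phi x)%:R * mn_mass w phi * 1).
  rewrite exchange_big; apply: eq_bigr => phi _ /=.
  rewrite -[X in X%:R * _](msetn_sum phi) natr_sum mulr_suml.
  by apply: eq_bigr => x _; rewrite mulr1.
apply: eq_bigr => x _; rewrite mn_mass_shift.
by congr (_ * _); apply: eq_bigr => psi _; rewrite mulr1.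
Qed.

Definition mn_fun K (omega : dist R X) : {fsfun msetn K X -> R with 0} :=
  [fsfun phi in [fset phi | phi : msetn K X] => mn_mass omega phi].

Lemma mn_funE K (omega : dist R X) phi :
  mn_fun K omega phi = mn_mass omega phi.
Proof. by rewrite fsfunE in_fset. Qed.

Lemma mn_sum1 K (omega : dist R X) :
  \sum_(phi <- finsupp (mn_fun K omega)) mn_fun K omega phi = 1.
Proof.
rewrite big_finsupp_fin //; under eq_bigr do rewrite mn_funE.
rewrite mn_mass_sum.
suff -> : \sum_x omega x = 1 by rewrite expr1n.
by rewrite -(dist_sum1 omega) big_finsupp_fin.
Qed.

Lemma mn_itv K (omega : dist R X) phi : 0 <= mn_fun K omega phi <= 1.
Proof.
have ge0 psi : 0 <= mn_fun K omega psi.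
  rewrite mn_funE mulr_ge0 ?divr_ge0 ?ler0n // prodr_ge0 // => x _.
  by rewrite exprn_ge0 //; case/andP: (dist_itv omega x).
rewrite ge0 -(mn_sum1 K omega) big_finsupp_fin // (bigD1 phi) //=.
by rewrite lerDl sumr_ge0.
Qed.

(* Multinomial distribution: K draws with replacement from omega. *)
Definition mn K (omega : dist R X) : dist R (msetn K X) :=
  Dist (@mn_itv K omega) (mn_sum1 K omega).

End Multinomial.

Lemma heads_subproof (K : nat) (phi : msetn K ('I_2 * 'I_2))
    (p q : 'I_2 * 'I_2) :
  p != q -> (phi p + phi q < K.+1)%N.
Proof.
move=> pq; rewrite ltnS -[leqRHS](msetn_sum phi) (bigD1 p) //= leq_add2l.
by rewrite (bigD1 q) 1?eq_sym //= leq_addr.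
Qed.

(* In 'I_2, 1 is heads and 0 is tails; heads counts the heads of the first
   coin and of the second coin. *)
Definition heads (K : nat) (phi : msetn K ('I_2 * 'I_2)) : 'I_K.+1 * 'I_K.+1 :=
  (Ordinal (heads_subproof phi (p := (1, 0)) (q := (1, 1)) isT),
   Ordinal (heads_subproof phi (p := (0, 1)) (q := (1, 1)) isT)).

(* Bivariate binomial distribution. *)
Definition bvbn (R : realType) (K : nat) (gamma : dist R ('I_2 * 'I_2)) :
    dist R ('I_K.+1 * 'I_K.+1) :=
  dmap (@heads K) (mn K gamma).

(* Main.v *)
Require Import Defs.
From mathcomp Require Import all_boot all_order all_algebra.
From mathcomp Require Import finmap reals.

(** The pair of head counts of a multiset of tosses is the sum of its tosses,
    taken with multiplicity and read as points of the plane
    ([grid_heads]).  So each coordinate of it has the form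
    [phi |-> \sum_x phi x * p x], where [p] is a coordinate of a single toss,
    and linearity of expectation reduces the theorem to the classical fact that
    under the multinomial distribution the expected multiplicity of [x] is
    [K * omega x] ([validity_mn_count]).  The latter holds because weighting a
    multiset by its multiplicity at [x] amounts to drawing [x] first, with
    weight [K * omega x], and then a multinomial multiset of size [K - 1], the
    total mass of which is 1. *)

Set Implicit Arguments.
Unset Strict Implicit.
Unset Printing Implicit Defensive.

Import Order.TTheory GRing.Theory Num.Theory.

Local Open Scope ring_scope.

Lemma validity_dmap (R : realType) (X Y : choiceType) (f : X -> Y)
    (omega : dist R X) (p : Y -> R) :
  validity (dmap f omega) p = validity omega (p \o f).
Proof. exact: dmap_sum. Qed.

Lemma validity_fin (R : realType) (X : finType) (omega : dist R X)
    (p : X -> R) :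
  validity omega p = \sum_x omega x * p x.
Proof. by apply: big_finsupp_fin => x ->; rewrite mul0r. Qed.

Lemma dist_sum1_fin (R : realType) (X : finType) (omega : dist R X) :
  \sum_x omega x = 1.
Proof. by rewrite -(dist_sum1 omega) big_finsupp_fin. Qed.

(** For positive [K], removing one copy of [x] turns the sum weighted by the
    multiplicity of [x] into [K * omega x] times the total mass for [K - 1]
    draws. *)
Lemma validity_mn_count (R : realType) (X : finType) (K : nat)
    (omega : dist R X) (x : X) :
  validity (mn K omega) (fun phi => (phi x)%:R) = K%:R * omega x.
Proof.
rewrite validity_fin; case: K => [|K].
  rewrite mul0r big1 // => phi _.
  by move: (msetn_le phi x); rewrite leqn0 => /eqP ->; rewrite mulr0.
under eq_bigr => phi _ do rewrite /= mn_funE mulrC -[_ * _]mulr1.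
rewrite mn_mass_shift; under eq_bigr do rewrite mulr1.
by rewrite mn_mass_sum dist_sum1_fin expr1n mulr1.
Qed.

Lemma validity_mn_sum (R : realType) (X : finType) (K : nat)
    (omega : dist R X) (p : X -> R) :
  validity (mn K omega) (fun phi => \sum_x (phi x)%:R * p x)
  = K%:R * validity omega p.
Proof.
rewrite [in RHS]validity_fin validity_fin mulr_sumr.
under eq_bigr do rewrite mulr_sumr.
rewrite exchange_big; apply: eq_bigr => x _ /=.
rewrite mulrA -validity_mn_count validity_fin mulr_suml.
by apply: eq_bigr => phi _; rewrite mulrA.
Qed.

(** Heads being encoded by 1 and tails by 0, a toss [(a, b)] contributes [a] to
    the first head count and [b] to the second. *)
Lemma grid_heads (R : realType) (K : nat) (phi : msetn K ('I_2 * 'I_2)) :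
  grid R (heads phi) = \sum_x (phi x)%:R *: @grid R 1 1 x.
Proof.
apply/rowP => i; rewrite summxE.
transitivity (\sum_(a < 2) \sum_(b < 2)
  (phi (a, b))%:R * (if i == 0 then a%:R else b%:R : R)); last first.
  by rewrite pair_bigA; apply: eq_bigr => -[a b] _; rewrite !mxE.
rewrite mxE !big_ord_recl !big_ord0 /= !addr0.
have -> : lift ord0 ord0 = 1 :> 'I_2 by apply/val_inj.
by case: ifP => _; rewrite ?mulr0 ?mulr1 ?add0r natrD.
Qed.

Theorem lemma4p1 (R : realType) (K : nat) (gamma : dist R ('I_2 * 'I_2)) :
  mean (@grid R K K) (bvbn K gamma) = K%:R *: mean (@grid R 1 1) gamma.
Proof.
apply/rowP => i; rewrite !mxE validity_dmap -validity_mn_sum.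
apply: eq_bigr => phi _; rewrite /= grid_heads summxE.
by congr (_ * _); apply: eq_bigr => x _; rewrite mxE.
Qed.
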